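(* Let $\alpha$, $\beta$ and $u^*$ be positive. Then the matching condition $u^*_\gamma=u^*$ has a unique solution $\gamma$ satisfying $\gamma>0$ if and only if $u^*<u^*_0$. If this is the case, then the unique solution to the system (for the unknown pair $(\Phi,\gamma)$ with $\gamma>0$) $$\Phi''+\frac{\eta}{2}\,\Phi'+\frac{\alpha\beta}{2}\,\delta(\eta-\alpha)-\frac{\gamma}{\eta^2}\,H(\alpha-\eta)\,\Phi=0 ,$$ $$\Phi(\eta)\to 0\ \text{ as }\eta\to\infty,\qquad \Phi(\alpha)=u^*,\qquad \Phi'(0)=0 ,$$ is given by $\Phi=\Phi_\gamma$ with this particular value of $\gamma$.
   Context: For $\gamma\ge 0$ set $\kappa=\kappa(\gamma)=\frac{1+\sqrt{4\gamma+1}}{2}$, so that $\kappa(\kappa-1)=\gamma$ and $\gamma>0$ is equivalent to $\kappa>1$. Let $M(a,b,z)=\sum_{n\ge0}\frac{(a)_n}{(b)_n}\frac{z^n}{n!}$ denote Kummer's confluent hypergeometric function (${}_1F_1$), and $\operatorname{erfc}(z)=\frac{2}{\sqrt\pi}\int_z^\infty e^{-y^2}\,dy$. Define $$u^*_\gamma=\left(\frac{\kappa\,M(\frac\kappa2+1,\kappa+\frac12,-\frac{\alpha^2}{4})}{\alpha\,M(\frac\kappa2,\kappa+\frac12,-\frac{\alpha^2}{4})}+\frac{\exp(-\frac{\alpha^2}{4})}{\sqrt\pi\,\operatorname{erfc}(\frac\alpha2)}\right)^{-1}\frac{\alpha\beta}{2}$$ and $$\Phi_\gamma(\eta)=\begin{cases}\dfrac{u^*_\gamma\,\eta^\kappa\,M(\frac\kappa2,\kappa+\frac12,-\frac{\eta^2}{4})}{\alpha^\kappa\,M(\frac\kappa2,\kappa+\frac12,-\frac{\alpha^2}{4})}&\text{if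 }0\le\eta<\alpha,\\[2ex]\dfrac{u^*_\gamma}{\operatorname{erfc}(\frac\alpha2)}\,\operatorname{erfc}\left(\frac\eta2\right)&\text{if }\eta\ge\alpha.\end{cases}$$ $u^*_0$ denotes the value of $u^*_\gamma$ at $\gamma=0$ (i.e. $\kappa=1$). $H$ is the Heaviside function and $\delta$ the Dirac distribution; the differential equation is posed on $(0,\infty)$ and its derivatives are understood in the sense of distributions (equivalently: $\Phi$ is continuous at $\alpha$, satisfies the equation without the $\delta$-term classically on $(0,\alpha)$ and on $(\alpha,\infty)$, and $\Phi'(\alpha+)-\Phi'(\alpha-)=-\alpha\beta/2$). The constant $\gamma>0$ is treated as part of the unknown. The condition $\Phi'(0)=0$ refers to the one-sided derivative at $0$. *)

(* Defs.v *)
(* Stdlib reals with Coquelicot. *)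
From Stdlib Require Import Reals Factorial.
From Coquelicot Require Import Coquelicot.
Open Scope R_scope.

Definition kappa (gamma : R) : R := (1 + sqrt (4 * gamma + 1)) / 2.

(* Rising factorial (a)_n = a (a + 1) ... (a + n - 1). *)
Fixpoint pochhammer (a : R) (n : nat) : R :=
  match n with
  | O => 1
  | S m => pochhammer a m * (a + INR m)
  end.

Definition kummerM (a b z : R) : R :=
  Series (fun n => pochhammer a n / pochhammer b n * (z ^ n / INR (fact n))).

Definition erfc (z : R) : R :=
  2 / sqrt PI *
  RInt_gen (fun y => exp (- (y ^ 2))) (at_point z) (Rbar_locally p_infty).

(* [Rpower 0 y] is 1, whereas 0 ^ y = 0 is meant here for y > 0. *)
Definition rpow (x y : R) : R := if Rle_dec x 0 then 0 else Rpower x y.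

Definition heaviside (x : R) : R := if Rlt_dec 0 x then 1 else 0.

Definition ustar_of (alpha beta gamma : R) : R :=
  let k := kappa gamma in
  let z := - (alpha ^ 2 / 4) in
  / (k * kummerM (k / 2 + 1) (k + 1 / 2) z
       / (alpha * kummerM (k / 2) (k + 1 / 2) z)
     + exp z / (sqrt PI * erfc (alpha / 2)))
  * (alpha * beta / 2).

Definition Phi_of (alpha beta gamma eta : R) : R :=
  let k := kappa gamma in
  if Rlt_dec eta alpha then
    ustar_of alpha beta gamma * rpow eta k
      * kummerM (k / 2) (k + 1 / 2) (- (eta ^ 2 / 4))
    / (rpow alpha k * kummerM (k / 2) (k + 1 / 2) (- (alpha ^ 2 / 4)))
  else
    ustar_of alpha beta gamma / erfc (alpha / 2) * erfc (eta / 2).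

(* The equation
     Phi'' + eta/2 Phi' + alpha beta/2 delta(eta - alpha)
       - gamma/eta^2 H(alpha - eta) Phi = 0   on (0, oo),
   read as: Phi is continuous at alpha, the equation without the delta term
   holds classically on (0, alpha) and on (alpha, oo), and the delta term is
   the jump of Phi' at alpha. Because [Derive] is total, differentiability of
   Phi and of Phi' is required separately. *)
Definition satisfies_equation
    (alpha beta gamma : R) (Phi : R -> R) : Prop :=
  continuous Phi alpha /\
  (forall eta : R, 0 < eta -> eta <> alpha ->
     ex_derive Phi eta /\ ex_derive (Derive Phi) eta /\
     Derive (Derive Phi) eta + eta / 2 * Derive Phi eta
       - gamma / eta ^ 2 * heaviside (alpha - eta) * Phi eta = 0) /\
  (exists dl dr : R,
     filterlim (Derive Phi) (at_left alpha) (locally dl) /\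
     filterlim (Derive Phi) (at_right alpha) (locally dr) /\
     dr - dl = - (alpha * beta / 2)).

(* The unknown pair (Phi, gamma); only the values of Phi on [0, oo) matter,
   so the derivative at 0 is the right derivative. *)
Definition is_solution
    (alpha beta ustar : R) (Phi : R -> R) (gamma : R) : Prop :=
  0 < gamma /\
  satisfies_equation alpha beta gamma Phi /\
  is_lim Phi p_infty 0 /\
  Phi alpha = ustar /\
  filterlim (fun h => (Phi h - Phi 0) / h) (at_right 0) (locally 0).

(* Main.v *)
(** On (0, alpha) the solutions regular at 0 are the multiples of
    g(eta) = eta^k M(k/2, k + 1/2, - eta^2/4) with k = kappa gamma, and
    eta g'/g = k B/A at t = eta^2/4, where A(t) = M(k/2, k + 1/2, - t) and
    B(t) = M(k/2 + 1, k + 1/2, - t). On (alpha, oo) the decaying solutions are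
    the multiples of erfc(eta/2). The jump condition is therefore the matching
    condition, and everything reduces to showing that k |-> k B/A maps
    [1, oo) continuously and increasingly onto a half-line.
    All these facts come from the system
    t A' = k/2 (B - A), t B' = (k - 1)/2 (A - B) - t B: each quantity S of
    interest satisfies t S' + (s + l t) S = R with s > 0 and R >= 0, which
    forces S >= 0 by looking at a negative minimum. This yields in turn
    A > 0, k B/A >= k - t, and
    0 < k2 B2/A2 - k1 B1/A1 <= k2 - k1 for k1 < k2.
    Uniqueness on (0, alpha) holds because the weighted Wronskian of a solution
    with g is constant and vanishes at 0. *)

Require Import Defs.
From Stdlib Require Import Reals Factorial Lra Lia.
From Coquelicot Require Import Coquelicot.
Open Scope R_scope.

(** * Kummer's function *)

Definition kummer_coef (a b : R) (n : nat) : R :=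
  pochhammer a n / pochhammer b n / INR (fact n).

Lemma kummerM_PSeries (a b z : R) : kummerM a b z = PSeries (kummer_coef a b) z.
Proof.
  apply Series_ext; intros n; unfold kummer_coef, Rdiv; ring.
Qed.

Lemma pochhammer_pos (a : R) (n : nat) : 0 < a -> 0 < pochhammer a n.
Proof.
  intros Ha; induction n as [|n IH]; simpl; [lra|].
  apply Rmult_lt_0_compat; [exact IH|]; pose proof (pos_INR n); lra.
Qed.

Lemma kummer_coef_S (a b : R) (n : nat) : 0 < b ->
  kummer_coef a b (S n)
  = kummer_coef a b n * ((a + INR n) / ((b + INR n) * INR (S n))).
Proof.
  intros Hb; unfold kummer_coef.
  pose proof (pochhammer_pos b n Hb); pose proof (pos_INR n).
  pose proof (INR_fact_lt_0 n); pose proof (lt_0_INR (S n) ltac:(lia)).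
  rewrite fact_simpl, mult_INR; simpl pochhammer; field; lra.
Qed.

Lemma is_lim_seq_inv_S : is_lim_seq (fun n => / INR (S n)) 0.
Proof.
  apply (is_lim_seq_incr_1 (fun n => / INR n)).
  replace (Finite 0) with (Rbar_inv p_infty) by reflexivity.
  apply is_lim_seq_inv; [apply is_lim_seq_INR | discriminate].
Qed.

(** Ratio test. Positive [a] and [b] keep every coefficient nonzero, and (a + n) b <= (a + b) (b +
    n) bounds the ratio of consecutive coefficients by a constant times 1 / (n + 1). *)
Lemma CV_radius_kummer (a b : R) : 0 < a -> 0 < b ->
  CV_radius (kummer_coef a b) = p_infty.
Proof.
  intros Ha Hb; apply CV_radius_infinite_DAlembert.
  - intros n; unfold kummer_coef.
    pose proof (pochhammer_pos a n Ha); pose proof (pochhammer_pos b n Hb).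
    pose proof (INR_fact_lt_0 n).
    apply Rgt_not_eq; repeat apply Rdiv_lt_0_compat; assumption.
  - apply is_lim_seq_le_le with
      (u := fun _ => 0) (w := fun n => ((a + b) / b) * / INR (S n)).
    + intros n; split; [apply Rabs_pos|].
      pose proof (pos_INR n); pose proof (lt_0_INR (S n) ltac:(lia)).
      assert (Hc : kummer_coef a b n <> 0).
      { pose proof (pochhammer_pos a n Ha); pose proof (pochhammer_pos b n Hb).
        pose proof (INR_fact_lt_0 n); unfold kummer_coef.
        apply Rgt_not_eq; repeat apply Rdiv_lt_0_compat; assumption. }
      rewrite kummer_coef_S by exact Hb.
      replace (_ / kummer_coef a b n)
        with ((a + INR n) / (b + INR n) * / INR (S n)) by (field; lra).
      rewrite Rabs_pos_eq.
      * apply Rmult_le_compat_r; [left; apply Rinv_0_lt_compat; lra|].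
        apply Rmult_le_reg_r with (b * (b + INR n)); [nra|].
        replace ((a + INR n) / (b + INR n) * (b * (b + INR n)))
          with ((a + INR n) * b) by (field; lra).
        replace ((a + b) / b * (b * (b + INR n)))
          with ((a + b) * (b + INR n)) by (field; lra).
        nra.
      * apply Rmult_le_pos; [|left; apply Rinv_0_lt_compat; lra].
        apply Rle_div_r; lra.
    + apply is_lim_seq_const.
    + replace (Finite 0) with (Rbar_mult ((a + b) / b) 0)
        by (simpl; f_equal; ring).
      apply is_lim_seq_scal_l, is_lim_seq_inv_S.
Qed.

Lemma ex_pseries_kummer (a b z : R) : 0 < a -> 0 < b ->
  ex_pseries (kummer_coef a b) z.
Proof.
  intros Ha Hb; apply CV_radius_inside; rewrite CV_radius_kummer by assumption.
  exact I.
Qed.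

Lemma is_derive_kummerM (a b z : R) : 0 < a -> 0 < b ->
  is_derive (kummerM a b) z (PSeries (PS_derive (kummer_coef a b)) z).
Proof.
  intros Ha Hb; apply is_derive_ext with (PSeries (kummer_coef a b)).
  - intros t; symmetry; apply kummerM_PSeries.
  - apply is_derive_PSeries; rewrite CV_radius_kummer by assumption; exact I.
Qed.

(** Both sides are the rising factorial (a)_{n+1}, split off at its first and at its last factor. *)
Lemma pochhammer_succ_l (a : R) (n : nat) :
  a * pochhammer (a + 1) n = pochhammer a n * (a + INR n).
Proof.
  induction n as [|n IH]; [simpl; ring|].
  change (a * (pochhammer (a + 1) n * (a + 1 + INR n))
          = pochhammer a n * (a + INR n) * (a + INR (S n))).
  rewrite <- IH, S_INR; ring.
Qed.

Lemma kummer_coef_up (a b : R) (n : nat) :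
  a * kummer_coef (a + 1) b n = kummer_coef a b n * (a + INR n).
Proof.
  unfold kummer_coef, Rdiv.
  rewrite <- 2!Rmult_assoc, pochhammer_succ_l; ring.
Qed.

Lemma kummerM_0 (a b : R) : kummerM a b 0 = 1.
Proof.
  rewrite kummerM_PSeries, PSeries_0; unfold kummer_coef; simpl; field.
Qed.

(** Coefficientwise: z d/dz multiplies the n-th coefficient by n, and by [kummer_coef_up] raising
    [a] multiplies it by (a + n) / a. *)
Lemma kummerM_derive_up (a b z : R) : 0 < a -> 0 < b ->
  z * Derive (kummerM a b) z = a * (kummerM (a + 1) b z - kummerM a b z).
Proof.
  intros Ha Hb; rewrite (is_derive_unique _ _ _ (is_derive_kummerM a b z Ha Hb)).
  rewrite <- PSeries_incr_1, !kummerM_PSeries.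
  rewrite Rmult_minus_distr_l, <- 2!PSeries_scal, <- PSeries_minus.
  2,3: apply ex_pseries_scal, ex_pseries_kummer; [apply Rmult_comm | lra..].
  apply PSeries_ext; intros [|n]; unfold PS_minus, PS_plus, PS_opp, PS_scal;
    unfold plus, opp, scal, mult; simpl; unfold mult; simpl.
  - rewrite kummer_coef_up; simpl; unfold zero; simpl; ring.
  - rewrite kummer_coef_up; unfold PS_derive; ring.
Qed.

(** The companion contiguous relation. Together with [kummerM_derive_up] it closes a first-order
    system for the pair M(a, b, z), M(a + 1, b, z). *)
Lemma kummerM_derive_down (a b z : R) : 0 < a -> 0 < b ->
  z * Derive (kummerM (a + 1) b) z
  = (b - a - 1) * (kummerM a b z - kummerM (a + 1) b z)
    + z * kummerM (a + 1) b z.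
Proof.
  intros Ha Hb.
  rewrite (is_derive_unique _ _ _
             (is_derive_kummerM (a + 1) b z ltac:(lra) Hb)).
  rewrite <- PSeries_incr_1, !kummerM_PSeries, <- PSeries_incr_1.
  assert (Ea : forall z, ex_pseries (kummer_coef a b) z)
    by (intros; apply ex_pseries_kummer; lra).
  assert (Eb : forall z, ex_pseries (kummer_coef (a + 1) b) z)
    by (intros; apply ex_pseries_kummer; lra).
  rewrite <- PSeries_minus, <- PSeries_scal, <- PSeries_plus; trivial.
  2: apply ex_pseries_scal, ex_pseries_minus; trivial; apply Rmult_comm.
  2: apply ex_pseries_incr_1; trivial.
  apply PSeries_ext; intros [|n]; unfold PS_minus, PS_plus, PS_opp, PS_scal;
    unfold plus, opp, scal, mult; simpl; unfold mult; simpl.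
  - unfold kummer_coef; simpl; unfold zero; simpl; field.
  - unfold PS_derive.
    (* The factor [a] lets [kummer_coef_up] express every coefficient at [a + 1] through those at
       [a]. *)
    apply Rmult_eq_reg_l with a; [|lra].
    pose proof (pos_INR n); pose proof (lt_0_INR (S n) ltac:(lia)).
    transitivity (INR (S n) * (a * kummer_coef (a + 1) b (S n))); [ring|].
    transitivity ((b - a - 1) * (a * kummer_coef a b (S n)
                                 - a * kummer_coef (a + 1) b (S n))
                  + a * kummer_coef (a + 1) b n); [|ring].
    rewrite !kummer_coef_up, kummer_coef_S by exact Hb.
    rewrite S_INR; field; rewrite <- S_INR; lra.
Qed.

Lemma ex_derive_kummerM (a b z : R) : 0 < a -> 0 < b ->
  ex_derive (kummerM a b) z.
Proof. intros Ha Hb; eexists; apply is_derive_kummerM; assumption. Qed.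

(** * Comparison in the parameter *)

(** Only points to the left of [m] are compared, so the lemma also covers a minimum at the right end
    of an interval. *)
Lemma Derive_left_min_le_0 (S : R -> R) (m d : R) : 0 < m ->
  is_derive S m d -> (forall t, 0 <= t <= m -> S m <= S t) -> d <= 0.
Proof.
  intros Hm Hd Hmin; apply Rnot_lt_le; intros Hpos.
  apply is_derive_Reals in Hd.
  (* With tolerance [d] itself, every difference quotient close to [m] is strictly positive, whereas
     minimality makes the left ones nonpositive. *)
  destruct (Hd d Hpos) as [del Hdel].
  pose proof (cond_pos del) as Hdp.
  set (h := Rmin (pos del) m / 2).
  assert (Hh : 0 < h /\ h < del /\ h < m).
  { unfold h; pose proof (Rmin_l del m); pose proof (Rmin_r del m).
    pose proof (Rmin_pos del m Hdp Hm); lra. }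
  specialize (Hdel (- h) ltac:(lra)).
  rewrite Rabs_Ropp, Rabs_pos_eq in Hdel by lra.
  specialize (Hdel ltac:(lra)); apply Rabs_def2 in Hdel.
  assert (Hq : 0 < (S (m + - h) - S m) / - h) by lra.
  assert (Hle : S m <= S (m + - h)) by (apply Hmin; lra).
  assert (Hq' : (S (m + - h) - S m) / - h * h <= 0)
    by (replace (_ * h) with (- (S (m + - h) - S m)) by (field; lra); lra).
  nra.
Qed.

(* At a negative minimum, [t * dS t <= 0] and [(s + l * t) * S t < 0]. *)
Lemma min_principle (S dS : R -> R) (s l : R) : 0 < s -> 0 <= l ->
  0 <= S 0 -> (forall t, is_derive S t (dS t)) ->
  (forall t, 0 < t -> 0 <= t * dS t + (s + l * t) * S t) ->
  forall t, 0 <= t -> 0 <= S t.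
Proof.
  intros Hs Hl H0 Hd HR T HT.
  destruct (continuity_ab_min S 0 T HT) as [m [Hmin Hm]].
  { intros c _; apply continuity_pt_filterlim, (ex_derive_continuous S c).
    eexists; apply Hd. }
  apply Rle_trans with (S m); [|apply Hmin; lra].
  apply Rnot_lt_le; intros Hneg.
  destruct (Req_dec m 0) as [->|Hm0]; [lra|].
  assert (Hdm : dS m <= 0).
  { apply (Derive_left_min_le_0 S m); [lra|apply Hd|].
    intros t Ht; apply Hmin; lra. }
  specialize (HR m ltac:(lra)).
  assert (0 <= l * m) by (apply Rmult_le_pos; lra).
  nra.
Qed.

(** After the weak version, a zero of [S] at some t > 0 would be a minimum over [0, t]; then
    [dS t <= 0] contradicts the strict inequality at [t]. *)
Lemma strict_min_principle (S dS : R -> R) (s l : R) : 0 < s -> 0 <= l ->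
  0 <= S 0 -> (forall t, is_derive S t (dS t)) ->
  (forall t, 0 < t -> 0 < t * dS t + (s + l * t) * S t) ->
  forall t, 0 < t -> 0 < S t.
Proof.
  intros Hs Hl H0 Hd HR t Ht.
  assert (HS : forall u, 0 <= u -> 0 <= S u).
  { apply min_principle with dS s l; trivial; intros u Hu; left; auto. }
  destruct (HS t ltac:(lra)) as [|Heq]; trivial.
  assert (Hdt : dS t <= 0).
  { apply (Derive_left_min_le_0 S t); [lra|apply Hd|].
    intros u Hu; rewrite <- Heq; apply HS; lra. }
  specialize (HR t Ht); rewrite <- Heq in HR; nra.
Qed.

Lemma nondecreasing_of_derive (P dP : R -> R) (a b : R) : a <= b ->
  (forall t, a <= t <= b -> is_derive P t (dP t)) ->
  (forall t, a <= t <= b -> 0 <= dP t) -> P a <= P b.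
Proof.
  intros Hab Hd Hp.
  destruct (MVT_gen P a b dP) as [c [Hc Heq]];
    rewrite Rmin_left, Rmax_right in * by lra.
  - intros t Ht; apply Hd; lra.
  - intros t Ht; apply continuity_pt_filterlim, (ex_derive_continuous P t).
    eexists; apply Hd, Ht.
  - specialize (Hp c Hc); nra.
Qed.

(** * The first-order system for A and B in the variable t *)

Definition KA (k t : R) : R := kummerM (k / 2) (k + 1 / 2) (- t).
Definition KB (k t : R) : R := kummerM (k / 2 + 1) (k + 1 / 2) (- t).

Lemma KA_0 (k : R) : KA k 0 = 1.
Proof. unfold KA; rewrite Ropp_0; apply kummerM_0. Qed.

Lemma KB_0 (k : R) : KB k 0 = 1.
Proof. unfold KB; rewrite Ropp_0; apply kummerM_0. Qed.

Lemma ex_derive_KA (k t : R) : 1 <= k -> ex_derive (KA k) t.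
Proof.
  intros Hk; apply (ex_derive_comp (kummerM (k / 2) (k + 1 / 2)) Ropp).
  - apply ex_derive_kummerM; lra.
  - auto_derive; trivial.
Qed.

Lemma ex_derive_KB (k t : R) : 1 <= k -> ex_derive (KB k) t.
Proof.
  intros Hk; apply (ex_derive_comp (kummerM (k / 2 + 1) (k + 1 / 2)) Ropp).
  - apply ex_derive_kummerM; lra.
  - auto_derive; trivial.
Qed.

Ltac solve_ex_derive :=
  repeat split;
  match goal with
  | |- ex_derive (fun x => KA _ x) _ => apply ex_derive_KA; assumption
  | |- ex_derive (fun x => KB _ x) _ => apply ex_derive_KB; assumption
  | _ => idtac
  end.

Section System.

Variable k : R.
Hypothesis Hk : 1 <= k.

(** Under z = - t both z and d/dz change sign, so z d/dz becomes t d/dt and the contiguous relation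
    carries over. *)
Lemma Derive_KA (t : R) : t * Derive (KA k) t = k / 2 * (KB k t - KA k t).
Proof.
  unfold KA, KB; rewrite <- kummerM_derive_up by lra.
  rewrite (Derive_comp (kummerM (k / 2) (k + 1 / 2)) Ropp).
  - rewrite Derive_opp, Derive_id; ring.
  - apply ex_derive_kummerM; lra.
  - auto_derive; trivial.
Qed.

Lemma Derive_KB (t : R) :
  t * Derive (KB k) t = (k - 1) / 2 * (KA k t - KB k t) - t * KB k t.
Proof.
  unfold KA, KB.
  rewrite (Derive_comp (kummerM (k / 2 + 1) (k + 1 / 2)) Ropp).
  - rewrite Derive_opp, Derive_id.
    transitivity (- t * Derive (kummerM (k / 2 + 1) (k + 1 / 2)) (- t)); [ring|].
    rewrite kummerM_derive_down by lra; field.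
  - apply ex_derive_kummerM; lra.
  - auto_derive; trivial.
Qed.

(** The product P = A B satisfies t P' + (k - 1/2 + t) P = k/2 B^2 + (k - 1)/2 A^2, whose right side
    is nonnegative before anything is known about the signs of A and B. *)
Lemma KA_KB_nonneg (t : R) : 0 <= t -> 0 <= KA k t * KB k t.
Proof.
  apply (min_principle (fun t => KA k t * KB k t)
    (fun t => Derive (KA k) t * KB k t + KA k t * Derive (KB k) t)
    (k - 1 / 2) 1); try lra.
  - rewrite KA_0, KB_0; lra.
  - intros u; auto_derive.
    + solve_ex_derive.
    + change (Derive (fun x => KA k x) u) with (Derive (KA k) u).
      change (Derive (fun x => KB k x) u) with (Derive (KB k) u); ring.
  - intros u Hu.
    rewrite Rmult_plus_distr_l, <- Rmult_assoc, Derive_KA.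
    replace (u * (KA k u * Derive (KB k) u))
      with (KA k u * (u * Derive (KB k) u)) by ring.
    rewrite Derive_KB.
    replace (_ + _) with (k / 2 * KB k u ^ 2 + (k - 1) / 2 * KA k u ^ 2)
      by field.
    pose proof (pow2_ge_0 (KA k u)); pose proof (pow2_ge_0 (KB k u)); nra.
Qed.

(* [t ^ k * KA k t ^ 2] is nondecreasing and positive near 0. *)
Lemma KA_neq_0 (t : R) : 0 <= t -> KA k t <> 0.
Proof.
  intros Ht Hz.
  destruct (Req_dec t 0) as [->|Ht0]; [rewrite KA_0 in Hz; lra|].
  assert (Hc : continuous (KA k) 0)
    by apply (ex_derive_continuous (KA k)), ex_derive_KA, Hk.
  assert (Hloc : locally 0 (fun u => 0 < KA k u)).
  { apply Hc; apply (open_gt 0); rewrite KA_0; lra. }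
  destruct Hloc as [eps Heps].
  pose proof (cond_pos eps) as Hep.
  set (u := Rmin (pos eps) t / 2).
  assert (Hu : 0 < u /\ u < eps /\ u < t).
  { unfold u; pose proof (Rmin_l eps t); pose proof (Rmin_r eps t).
    pose proof (Rmin_pos eps t Hep ltac:(lra)); lra. }
  assert (HAu : 0 < KA k u).
  { apply Heps; unfold ball; simpl; unfold AbsRing_ball, abs, minus, plus, opp;
      simpl; rewrite Rabs_pos_eq; lra. }
  assert (Hmon : exp (k * ln u) * KA k u ^ 2 <= exp (k * ln t) * KA k t ^ 2).
  (* By the equation for A, the A^2 terms in the derivative cancel and v^(k-1) k A B is left, which
     [KA_KB_nonneg] makes nonnegative. *)
  { apply (nondecreasing_of_derive (fun v => exp (k * ln v) * KA k v ^ 2)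
      (fun v => exp (k * ln v) * (k * KA k v * KB k v / v))); [lra| |].
    - intros v Hv; auto_derive.
      + split; [lra | solve_ex_derive].
      + change (Derive (fun x => KA k x) v) with (Derive (KA k) v).
        replace (Derive (KA k) v) with (k / 2 * (KB k v - KA k v) / v)
          by (rewrite <- Derive_KA; field; lra).
        field; lra.
    - intros v Hv; apply Rmult_le_pos; [left; apply exp_pos|].
      pose proof (KA_KB_nonneg v ltac:(lra)).
      rewrite Rmult_assoc; apply Rmult_le_pos; [nra|].
      left; apply Rinv_0_lt_compat; lra. }
  rewrite Hz in Hmon; simpl in Hmon; pose proof (exp_pos (k * ln u)).
  assert (0 < KA k u ^ 2) by (apply pow_lt, HAu); simpl in *; nra.
Qed.

Lemma KA_pos (t : R) : 0 <= t -> 0 < KA k t.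
Proof.
  intros Ht; apply Rnot_le_lt; intros Hle.
  destruct (IVT_gen (KA k) 0 t 0) as [u [Hu Hz]].
  - intros u; apply continuity_pt_filterlim, (ex_derive_continuous (KA k)).
    apply ex_derive_KA, Hk.
  - rewrite KA_0, Rmin_right, Rmax_left; lra.
  - rewrite Rmin_left in Hu by lra; apply (KA_neq_0 u); [lra|exact Hz].
Qed.

Lemma KB_nonneg (t : R) : 0 <= t -> 0 <= KB k t.
Proof.
  intros Ht; pose proof (KA_KB_nonneg t Ht); pose proof (KA_pos t Ht); nra.
Qed.

(** With D the quantity in question, t D' + (k - 1/2 + t/2) D = (t/2 + t^2/2) A >= 0. Dividing by A
    turns the conclusion into k B/A >= k - t, the growth in k that makes the matching condition
    solvable. *)
Lemma KB_lower (t : R) : 0 <= t -> 0 <= k * (KB k t - KA k t) + t * KA k t.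
Proof.
  apply (min_principle (fun t => k * (KB k t - KA k t) + t * KA k t)
    (fun t => k * (Derive (KB k) t - Derive (KA k) t)
              + (KA k t + t * Derive (KA k) t))
    (k - 1 / 2) (1 / 2)); try lra.
  - rewrite KA_0, KB_0; lra.
  - intros u; auto_derive.
    + solve_ex_derive.
    + change (Derive (fun x => KA k x) u) with (Derive (KA k) u).
      change (Derive (fun x => KB k x) u) with (Derive (KB k) u); ring.
  - intros u Hu; rewrite Derive_KA.
    replace (u * (k * (Derive (KB k) u - Derive (KA k) u)
                  + (KA k u + k / 2 * (KB k u - KA k u))))
      with (k * (u * Derive (KB k) u - u * Derive (KA k) u)
            + u * (KA k u + k / 2 * (KB k u - KA k u))) by ring.
    rewrite Derive_KA, Derive_KB.
    replace (_ + _) with ((u / 2 + u * u / 2) * KA k u) by field.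
    pose proof (KA_pos u ltac:(lra)); apply Rmult_le_pos; nra.
Qed.

End System.

(** * Comparison of k B/A for two values of k *)

Section Comparison.

Variables k1 k2 : R.
Hypothesis Hk1 : 1 <= k1.
Hypothesis Hk2 : 1 <= k2.

(** The difference of the two quotients k B/A, cleared of its positive denominator A1 A2; it
    therefore has the same sign. *)
Let S (t : R) : R := k2 * KB k2 t * KA k1 t - k1 * KB k1 t * KA k2 t.
Let dS (t : R) : R :=
  k2 * (Derive (KB k2) t * KA k1 t + KB k2 t * Derive (KA k1) t)
  - k1 * (Derive (KB k1) t * KA k2 t + KB k1 t * Derive (KA k2) t).

Let is_derive_S (t : R) : is_derive S t (dS t).
Proof.
  unfold S, dS; auto_derive.
  - solve_ex_derive.
  - change (Derive (fun x => KA k1 x) t) with (Derive (KA k1) t).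
    change (Derive (fun x => KB k1 x) t) with (Derive (KB k1) t).
    change (Derive (fun x => KA k2 x) t) with (Derive (KA k2) t).
    change (Derive (fun x => KB k2 x) t) with (Derive (KB k2) t); ring.
Qed.

(** The B1 B2 terms cancel, and the mixed terms A1 B2 and A2 B1 recombine into a multiple of [S].
    The source carries the difference of the two values of gamma = k (k - 1). *)
Let S_equation (t : R) :
  t * dS t + ((k1 + k2 - 1) / 2 + t) * S t
  = (k2 * (k2 - 1) - k1 * (k1 - 1)) / 2 * KA k1 t * KA k2 t.
Proof.
  unfold S, dS.
  replace (t * _)
    with (k2 * (t * Derive (KB k2) t * KA k1 t + KB k2 t * (t * Derive (KA k1) t))
    - k1 * (t * Derive (KB k1) t * KA k2 t + KB k1 t * (t * Derive (KA k2) t)))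
    by ring.
  rewrite !Derive_KA, !Derive_KB by assumption; field.
Qed.

Lemma KB_KA_increasing (t : R) : k1 < k2 -> 0 < t ->
  k1 * KB k1 t * KA k2 t < k2 * KB k2 t * KA k1 t.
Proof.
  intros Hlt Ht; apply Rlt_0_minus; change (0 < S t).
  apply (strict_min_principle S dS ((k1 + k2 - 1) / 2) 1); try lra.
  - unfold S; rewrite !KA_0, !KB_0; lra.
  - exact is_derive_S.
  - intros u Hu; rewrite Rmult_1_l, S_equation.
    pose proof (KA_pos k1 Hk1 u ltac:(lra)).
    pose proof (KA_pos k2 Hk2 u ltac:(lra)).
    repeat apply Rmult_lt_0_compat; trivial; nra.
Qed.

(** The defect (k2 - k1) A1 A2 - S vanishes at 0, and its equation has the source (k2 - k1) A1 (k2
    (B2 - A2) + t A2), nonnegative by [KB_lower]. This bound supplies the continuity of k B/A in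
    k. *)
Lemma KB_KA_lipschitz (t : R) : k1 <= k2 -> 0 <= t ->
  k2 * KB k2 t * KA k1 t - k1 * KB k1 t * KA k2 t
  <= (k2 - k1) * KA k1 t * KA k2 t.
Proof.
  intros Hle Ht; apply Rminus_le_0.
  change (0 <= (k2 - k1) * KA k1 t * KA k2 t - S t).
  apply (min_principle (fun t => (k2 - k1) * KA k1 t * KA k2 t - S t)
    (fun t => (k2 - k1) * (Derive (KA k1) t * KA k2 t + KA k1 t * Derive (KA k2) t)
              - dS t) (k1 + 1 / 2 - 1) 1); try lra.
  - unfold S; rewrite !KA_0, !KB_0; lra.
  - intros u; auto_derive.
    + solve_ex_derive.
      eexists; apply is_derive_S.
    + change (Derive (fun x => KA k1 x) u) with (Derive (KA k1) u).
      change (Derive (fun x => KA k2 x) u) with (Derive (KA k2) u).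
      change (Derive (fun x => S x) u) with (Derive S u).
      rewrite (is_derive_unique _ _ _ (is_derive_S u)); ring.
  - intros u Hu.
    replace (u * _) with
      ((k2 - k1) * (u * Derive (KA k1) u * KA k2 u
                    + KA k1 u * (u * Derive (KA k2) u)) - u * dS u) by ring.
    replace (u * dS u) with
      ((k2 * (k2 - 1) - k1 * (k1 - 1)) / 2 * KA k1 u * KA k2 u
       - ((k1 + k2 - 1) / 2 + u) * S u) by (rewrite <- S_equation; ring).
    rewrite !Derive_KA by assumption.
    replace (_ + _)
      with ((k2 - k1) * KA k1 u * (k2 * (KB k2 u - KA k2 u) + u * KA k2 u))
      by (unfold S; field).
    pose proof (KA_pos k1 Hk1 u ltac:(lra)).
    pose proof (KB_lower k2 Hk2 u ltac:(lra)).
    repeat apply Rmult_le_pos; lra.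
Qed.

End Comparison.

(** * The complementary error function *)

Definition gauss (y : R) : R := exp (- (y ^ 2)).

Lemma gauss_pos (y : R) : 0 < gauss y.
Proof. apply exp_pos. Qed.

Lemma continuous_gauss (y : R) : continuous gauss y.
Proof.
  apply (ex_derive_continuous gauss); unfold gauss; auto_derive; trivial.
Qed.

Definition gauss_int (x : R) : R := RInt gauss 0 x.

Lemma is_derive_gauss_int (x : R) : is_derive gauss_int x (gauss x).
Proof.
  apply (is_derive_RInt gauss gauss_int 0 x); [|apply continuous_gauss].
  apply filter_forall; intros y; apply (RInt_correct gauss 0 y).
  apply (ex_RInt_continuous gauss); intros z _; apply continuous_gauss.
Qed.

Lemma gauss_int_increasing (x y : R) : x < y -> gauss_int x < gauss_int y.
Proof.
  intros Hxy.
  destruct (MVT_gen gauss_int x y gauss) as [c [_ Heq]].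
  - intros t _; apply is_derive_gauss_int.
  - intros t _.
    apply continuity_pt_filterlim, (ex_derive_continuous gauss_int).
    eexists; apply is_derive_gauss_int.
  - pose proof (gauss_pos c); nra.
Qed.

(* [exp (- y^2) <= 1 / (1 + y^2)], the derivative of [atan]. *)
Lemma gauss_int_le_atan (x : R) : 0 <= x -> gauss_int x <= atan x.
Proof.
  intros Hx.
  assert (H : atan 0 - gauss_int 0 <= atan x - gauss_int x).
  { apply (nondecreasing_of_derive (fun t => atan t - gauss_int t)
             (fun t => / (1 + t ^ 2) - gauss t)); trivial.
    - intros t _; apply (is_derive_minus (V := R_NormedModule)).
      + apply is_derive_Reals, derivable_pt_lim_atan.
      + apply is_derive_gauss_int.
    - intros t _; unfold gauss; rewrite exp_Ropp.
      pose proof (pow2_ge_0 t).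
      apply -> Rminus_le_0; apply Rinv_le_contravar; [lra|].
      apply exp_ineq1_le. }
  unfold gauss_int at 1 in H; rewrite RInt_point, atan_0 in H.
  unfold zero in H; simpl in H; lra.
Qed.

(** A strictly increasing function bounded by PI / 2 tends to its supremum without attaining it; the
    strictness is what makes [erfc] positive. *)
Lemma gauss_int_lim : exists l : R,
  is_lim gauss_int p_infty l /\ forall x, gauss_int x < l.
Proof.
  destruct (completeness (fun y => exists x, y = gauss_int x)) as [l [Hub Hlub]].
  - exists (PI / 2); intros y [x ->].
    (* The comparison with [atan] holds only for nonnegative arguments, so negative [x] are first
       moved up to 0. *)
    apply Rle_trans with (gauss_int (Rmax 0 x)).
    + destruct (Rle_lt_or_eq_dec x (Rmax 0 x) (Rmax_r 0 x)) as [Hlt|<-];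
        [left; apply gauss_int_increasing, Hlt | right; reflexivity].
    + apply Rle_trans with (atan (Rmax 0 x)).
      * apply gauss_int_le_atan, Rmax_l.
      * left; apply atan_bound.
  - exists (gauss_int 0), 0; reflexivity.
  - exists l.
    assert (Hlt : forall x, gauss_int x < l).
    { intros x; apply Rlt_le_trans with (gauss_int (x + 1)).
      - apply gauss_int_increasing; lra.
      - apply Hub; eexists; reflexivity. }
    split; [|exact Hlt].
    apply is_lim_spec; intros eps; simpl.
    destruct (Classical_Prop.classic (exists x, l - eps < gauss_int x))
      as [[x Hx]|Hno].
    + exists x; intros y Hy.
      pose proof (gauss_int_increasing x y Hy); pose proof (Hlt y).
      apply Rabs_def1; lra.
    + exfalso; pose proof (cond_pos eps).
      assert (l <= l - eps); [|lra].
      apply Hlub; intros y [x ->]; apply Rnot_lt_le; intros Hx.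
      apply Hno; exists x; exact Hx.
Qed.

(** Trades the improper integral for an antiderivative and its limit, from which the sign, the
    derivative and the decay of [erfc] are read off. *)
Lemma erfc_gauss_int (l z : R) : is_lim gauss_int p_infty l ->
  erfc z = 2 / sqrt PI * (l - gauss_int z).
Proof.
  intros Hl; unfold erfc; f_equal; change (fun y => exp (- (y ^ 2))) with gauss.
  apply is_RInt_gen_unique.
  assert (HD : forall x, Derive gauss_int x = gauss x)
    by (intros x; apply is_derive_unique, is_derive_gauss_int).
  apply is_RInt_gen_ext with (Derive gauss_int).
  { apply filter_forall; intros p x _; apply HD. }
  apply (is_RInt_gen_Derive gauss_int).
  - apply filter_forall; intros p x _; eexists; apply is_derive_gauss_int.
  - apply filter_forall; intros p x _.
    apply continuous_ext with gauss; [intros y; symmetry; apply HD|].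
    apply continuous_gauss.
  - intros P HP; exact (locally_singleton _ P HP).
  - exact Hl.
Qed.

Lemma sqrt_PI_pos : 0 < sqrt PI.
Proof. apply sqrt_lt_R0, PI_RGT_0. Qed.

Lemma erfc_pos (z : R) : 0 < erfc z.
Proof.
  destruct gauss_int_lim as [l [Hl Hlt]].
  rewrite (erfc_gauss_int l z Hl); pose proof (Hlt z); pose proof sqrt_PI_pos.
  apply Rmult_lt_0_compat; [apply Rdiv_lt_0_compat|]; lra.
Qed.

Lemma is_derive_erfc (z : R) :
  is_derive erfc z (- (2 / sqrt PI * exp (- (z ^ 2)))).
Proof.
  destruct gauss_int_lim as [l [Hl _]].
  apply is_derive_ext with (fun t => 2 / sqrt PI * (l - gauss_int t)).
  { intros t; symmetry; apply erfc_gauss_int, Hl. }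
  auto_derive; [eexists; apply is_derive_gauss_int|].
  change (Derive (fun x => gauss_int x) z) with (Derive gauss_int z).
  rewrite (is_derive_unique _ _ _ (is_derive_gauss_int z)); unfold gauss; ring.
Qed.

Lemma is_lim_erfc : is_lim erfc p_infty 0.
Proof.
  destruct gauss_int_lim as [l [Hl _]].
  apply is_lim_ext with (fun t => 2 / sqrt PI * (l - gauss_int t)).
  { intros t; symmetry; apply erfc_gauss_int, Hl. }
  replace (Finite 0) with (Rbar_mult (2 / sqrt PI) (l - l))
    by (simpl; f_equal; ring).
  apply is_lim_scal_l, is_lim_minus'; [apply is_lim_const | exact Hl].
Qed.

Lemma is_derive_erfc_half (eta : R) :
  is_derive (fun x => erfc (x / 2)) eta (- (/ sqrt PI * exp (- (eta ^ 2 / 4)))).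
Proof.
  replace (- (/ sqrt PI * exp (- (eta ^ 2 / 4))))
    with (scal (/ 2) (- (2 / sqrt PI * exp (- ((eta / 2) ^ 2))))).
  - apply (is_derive_comp erfc (fun x => x / 2)); [apply is_derive_erfc|].
    auto_derive; trivial; field.
  - unfold scal, mult; simpl; unfold mult; simpl.
    replace (eta / 2 * (eta / 2 * 1)) with (eta * (eta * 1) / 4) by field.
    pose proof sqrt_PI_pos; field; lra.
Qed.

Lemma is_lim_erfc_half : is_lim (fun x => erfc (x / 2)) p_infty 0.
Proof.
  apply (is_lim_comp erfc (fun x => x / 2) p_infty 0 p_infty).
  - exact is_lim_erfc.
  - apply is_lim_spec; intros M; exists (2 * M); intros x Hx; lra.
  - exists 0; discriminate.
Qed.

(** * The solution near 0 *)

Lemma filterlim_Rpower_0 (s : R) : 0 < s ->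
  filterlim (fun x => Rpower x s) (at_right 0) (locally 0).
Proof.
  intros Hs; unfold Rpower.
  apply (filterlim_comp R R R (fun x => s * ln x) exp (at_right 0)
           (Rbar_locally m_infty) (locally 0)).
  - apply (filterlim_comp R R R ln (Rmult s) (at_right 0)
             (Rbar_locally m_infty) (Rbar_locally m_infty)).
    + exact is_lim_ln_0.
    + assert (Hlim := is_lim_scal_l (fun x => x) s m_infty m_infty
                        (is_lim_id m_infty)).
      replace (Rbar_mult s m_infty) with m_infty in Hlim; [exact Hlim|].
      simpl; destruct (Rle_dec 0 s) as [Hle|]; [|lra].
      destruct (Rle_lt_or_eq_dec 0 s Hle); [reflexivity|lra].
  - exact is_lim_exp_m.
Qed.

Definition profile (k eta : R) : R := rpow eta k * KA k (eta ^ 2 / 4).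
(** A closed form of the derivative of [profile k] on (0, oo), free of derivatives of Kummer
    functions. *)
Definition slope (k eta : R) : R := k * Rpower eta (k - 1) * KB k (eta ^ 2 / 4).

Lemma rpow_pos_arg (x y : R) : 0 < x -> rpow x y = Rpower x y.
Proof. intros Hx; unfold rpow; destruct (Rle_dec x 0); [lra|reflexivity]. Qed.

Lemma profile_nonpos_arg (k eta : R) : eta <= 0 -> profile k eta = 0.
Proof. intros H; unfold profile, rpow; destruct (Rle_dec eta 0); [ring|lra]. Qed.

Lemma locally_between (a x b : R) : a < x < b -> locally x (fun y => a < y < b).
Proof.
  intros [Ha Hb]; apply filter_and; [apply open_gt, Ha | apply open_lt, Hb].
Qed.

Lemma at_right_between (a b : R) : a < b -> at_right a (fun y => a < y < b).
Proof.
  intros Hab; unfold at_right, within.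
  apply (filter_imp (fun y => y < b)); [tauto|apply open_lt, Hab].
Qed.

Lemma at_left_between (a b : R) : a < b -> at_left b (fun y => a < y < b).
Proof.
  intros Hab; unfold at_left, within.
  apply (filter_imp (fun y => a < y)); [tauto|apply open_gt, Hab].
Qed.

Section Profile.

Variable k : R.
Hypothesis Hk : 1 <= k.

Lemma profile_pos (eta : R) : 0 < eta -> 0 < profile k eta.
Proof.
  intros He; unfold profile; rewrite rpow_pos_arg by exact He.
  apply Rmult_lt_0_compat; [apply exp_pos|].
  apply KA_pos; [exact Hk|]; pose proof (pow2_ge_0 eta); lra.
Qed.

Lemma Rpower_pred (eta : R) : 0 < eta -> Rpower eta k = eta * Rpower eta (k - 1).
Proof.
  intros He; rewrite <- (Rpower_1 eta He) at 2; rewrite <- Rpower_plus.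
  f_equal; ring.
Qed.

(** At t = eta^2/4 the system gives d/deta A(t) = (k / eta) (B - A), so the two A terms of the
    product rule cancel. *)
Lemma is_derive_profile (eta : R) : 0 < eta ->
  is_derive (profile k) eta (slope k eta).
Proof.
  intros He.
  apply is_derive_ext_loc with (fun x => exp (k * ln x) * KA k (x ^ 2 / 4)).
  { apply (filter_imp (fun y => 0 < y)); [|apply open_gt, He].
    intros y Hy; unfold profile; rewrite rpow_pos_arg by exact Hy; reflexivity. }
  auto_derive.
  - split; [exact He|split; [|trivial]].
    apply ex_derive_KA, Hk.
  - change (Derive (fun x => KA k x)) with (Derive (KA k)).
    change (exp (k * ln eta)) with (Rpower eta k); unfold slope.
    change (eta * (eta * 1) * / 4) with (eta ^ 2 / 4).
    assert (Ht : eta ^ 2 / 4 <> 0) by (pose proof (pow_lt eta 2 He); lra).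
    replace (Derive (KA k) (eta ^ 2 / 4))
      with (k / 2 * (KB k (eta ^ 2 / 4) - KA k (eta ^ 2 / 4)) / (eta ^ 2 / 4))
      by (rewrite <- Derive_KA by exact Hk; field; lra).
    rewrite Rpower_pred by exact He; field; lra.
Qed.

(** Here d/deta B(t) = ((k - 1) / eta) (A - B) - (eta / 2) B, and the B / eta terms cancel. The
    outcome is the differential equation on (0, alpha) with gamma = k (k - 1). *)
Lemma is_derive_slope (eta : R) : 0 < eta ->
  is_derive (slope k) eta
    (k * (k - 1) / eta ^ 2 * profile k eta - eta / 2 * slope k eta).
Proof.
  intros He; unfold slope, Rpower at 1; auto_derive.
  - split; [exact He|split; [|trivial]].
    apply ex_derive_KB, Hk.
  - change (Derive (fun x => KB k x)) with (Derive (KB k)).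
    change (exp ((k - 1) * ln eta)) with (Rpower eta (k - 1)).
    unfold profile; rewrite rpow_pos_arg, Rpower_pred by exact He.
    change (eta * (eta * 1) * / 4) with (eta ^ 2 / 4).
    assert (Ht : eta ^ 2 / 4 <> 0) by (pose proof (pow_lt eta 2 He); lra).
    replace (Derive (KB k) (eta ^ 2 / 4))
      with (((k - 1) / 2 * (KA k (eta ^ 2 / 4) - KB k (eta ^ 2 / 4))
             - eta ^ 2 / 4 * KB k (eta ^ 2 / 4)) / (eta ^ 2 / 4))
      by (rewrite <- Derive_KB by exact Hk; field; lra).
    field; lra.
Qed.

Lemma filterlim_KA_sqr :
  filterlim (fun x => KA k (x ^ 2 / 4)) (at_right 0) (locally 1).
Proof.
  assert (Hc : continuous (fun x => KA k (x ^ 2 / 4)) 0).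
  { apply (ex_derive_continuous (fun x => KA k (x ^ 2 / 4))).
    auto_derive; apply ex_derive_KA, Hk. }
  unfold continuous in Hc.
  replace (0 ^ 2 / 4) with 0 in Hc by field; rewrite KA_0 in Hc.
  eapply filterlim_filter_le_1; [apply filter_le_within|exact Hc].
Qed.

Lemma filterlim_KB_sqr :
  filterlim (fun x => KB k (x ^ 2 / 4)) (at_right 0) (locally 1).
Proof.
  assert (Hc : continuous (fun x => KB k (x ^ 2 / 4)) 0).
  { apply (ex_derive_continuous (fun x => KB k (x ^ 2 / 4))).
    auto_derive; apply ex_derive_KB, Hk. }
  unfold continuous in Hc.
  replace (0 ^ 2 / 4) with 0 in Hc by field; rewrite KB_0 in Hc.
  eapply filterlim_filter_le_1; [apply filter_le_within|exact Hc].
Qed.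

End Profile.

Lemma filterlim_Rmult (T : Type) (F : (T -> Prop) -> Prop) (FF : Filter F)
  (f g : T -> R) (a b : R) :
  filterlim f F (locally a) -> filterlim g F (locally b) ->
  filterlim (fun x => f x * g x) F (locally (a * b)).
Proof.
  intros Hf Hg; eapply filterlim_comp_2; [exact Hf|exact Hg|].
  apply (filterlim_mult a b).
Qed.

(** The factor eta^(k-1) tends to 0 because k > 1; this is where gamma > 0 produces the condition
    Phi'(0) = 0. *)
Lemma filterlim_slope_0 (k : R) : 1 < k ->
  filterlim (slope k) (at_right 0) (locally 0).
Proof.
  (* The second 0 is the limit value; the first is the base point of [at_right]. *)
  intros Hk; replace 0 with (k * 0 * 1) at 2 by ring; unfold slope.
  apply filterlim_Rmult; [apply within_filter, locally_filter| |].
  - apply filterlim_Rmult; [apply within_filter, locally_filter| |].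
    + apply filterlim_const.
    + apply filterlim_Rpower_0; lra.
  - apply filterlim_KB_sqr; lra.
Qed.

Lemma filterlim_profile_div_0 (k : R) : 1 < k ->
  filterlim (fun x => profile k x / x) (at_right 0) (locally 0).
Proof.
  intros Hk.
  apply filterlim_ext_loc with (fun x => Rpower x (k - 1) * KA k (x ^ 2 / 4)).
  { apply (filter_imp (fun y => 0 < y < 1)); [|apply at_right_between; lra].
    intros y Hy; unfold profile; rewrite rpow_pos_arg, (Rpower_pred k) by lra.
    field; lra. }
  replace 0 with (0 * 1) at 2 by ring.
  apply filterlim_Rmult; [apply within_filter, locally_filter| |].
  - apply filterlim_Rpower_0; lra.
  - apply filterlim_KA_sqr; lra.
Qed.

Lemma filterlim_profile_0 (k : R) : 1 < k ->
  filterlim (profile k) (at_right 0) (locally 0).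
Proof.
  intros Hk.
  apply filterlim_ext_loc with (fun x => profile k x / x * x).
  { apply (filter_imp (fun y => 0 < y < 1)); [|apply at_right_between; lra].
    intros y Hy; field; lra. }
  replace 0 with (0 * 0) at 2 by ring.
  apply filterlim_Rmult; [apply within_filter, locally_filter| |].
  - apply filterlim_profile_div_0, Hk.
  - apply (filterlim_filter_le_1 (F := locally 0)); [apply filter_le_within|].
    apply filterlim_id.
Qed.

(** * The matching condition *)

Lemma kappa_ge_1 (gamma : R) : 0 <= gamma -> 1 <= kappa gamma.
Proof.
  intros Hg; unfold kappa.
  assert (1 <= sqrt (4 * gamma + 1)); [|lra].
  rewrite <- sqrt_1 at 1; apply sqrt_le_1_alt; lra.
Qed.

Lemma kappa_increasing (g1 g2 : R) : 0 <= g1 -> g1 < g2 -> kappa g1 < kappa g2.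
Proof.
  intros H0 Hlt; unfold kappa.
  assert (sqrt (4 * g1 + 1) < sqrt (4 * g2 + 1)); [|lra].
  apply sqrt_lt_1_alt; lra.
Qed.

Lemma kappa_0 : kappa 0 = 1.
Proof. unfold kappa; rewrite Rmult_0_r, Rplus_0_l, sqrt_1; field. Qed.

Lemma kappa_gt_1 (gamma : R) : 0 < gamma -> 1 < kappa gamma.
Proof. intros Hg; rewrite <- kappa_0; apply kappa_increasing; lra. Qed.

Lemma kappa_spec (gamma : R) : 0 <= gamma ->
  kappa gamma * (kappa gamma - 1) = gamma.
Proof.
  intros Hg; unfold kappa.
  pose proof (sqrt_sqrt (4 * gamma + 1) ltac:(lra)); nra.
Qed.

Lemma kappa_of_product (k : R) : 1 <= k -> kappa (k * (k - 1)) = k.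
Proof.
  intros Hk; unfold kappa.
  replace (4 * (k * (k - 1)) + 1) with ((2 * k - 1) * (2 * k - 1)) by ring.
  rewrite sqrt_square by lra; field.
Qed.

(* [eta * slope / profile] at [t = eta ^ 2 / 4]. *)
Definition log_slope (t k : R) : R := k * KB k t / KA k t.

Lemma log_slope_nonneg (t k : R) : 0 <= t -> 1 <= k -> 0 <= log_slope t k.
Proof.
  intros Ht Hk; unfold log_slope.
  pose proof (KA_pos k Hk t Ht); pose proof (KB_nonneg k Hk t Ht).
  apply Rle_div_r; [assumption|]; rewrite Rmult_0_l; nra.
Qed.

Lemma log_slope_lower (t k : R) : 0 <= t -> 1 <= k -> k - t <= log_slope t k.
Proof.
  intros Ht Hk; unfold log_slope.
  pose proof (KA_pos k Hk t Ht); pose proof (KB_lower k Hk t Ht).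
  apply Rle_div_r; [assumption|]; lra.
Qed.

Lemma log_slope_increasing (t k1 k2 : R) : 0 < t -> 1 <= k1 -> k1 < k2 ->
  log_slope t k1 < log_slope t k2.
Proof.
  intros Ht Hk1 Hlt; unfold log_slope.
  pose proof (KA_pos k1 Hk1 t ltac:(lra)).
  pose proof (KA_pos k2 ltac:(lra) t ltac:(lra)).
  pose proof (KB_KA_increasing k1 k2 Hk1 ltac:(lra) t Hlt Ht).
  apply Rmult_lt_reg_r with (KA k1 t * KA k2 t); [nra|].
  field_simplify; lra.
Qed.

Lemma log_slope_lipschitz (t k1 k2 : R) : 0 < t -> 1 <= k1 -> k1 <= k2 ->
  Rabs (log_slope t k2 - log_slope t k1) <= k2 - k1.
Proof.
  intros Ht Hk1 Hle.
  rewrite Rabs_pos_eq.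
  - pose proof (KA_pos k1 Hk1 t ltac:(lra)).
    pose proof (KA_pos k2 ltac:(lra) t ltac:(lra)).
    pose proof (KB_KA_lipschitz k1 k2 Hk1 ltac:(lra) t Hle ltac:(lra)).
    unfold log_slope; apply Rmult_le_reg_r with (KA k1 t * KA k2 t); [nra|].
    field_simplify; lra.
  - apply -> Rminus_le_0; destruct Hle as [Hlt| ->]; [|right; reflexivity].
    left; apply log_slope_increasing; assumption.
Qed.

(** [IVT_gen] asks for continuity on the whole line. Truncating with [Rmax 1] extends the function
    from [1, oo) and keeps the Lipschitz constant 1, so delta = eps works. *)
Lemma continuity_log_slope (t : R) : 0 < t ->
  continuity (fun k => log_slope t (Rmax 1 k)).
Proof.
  intros Ht x; apply continuity_pt_locally; intros eps.
  exists eps; intros y Hy.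
  change (Rabs (y - x) < eps) in Hy.
  assert (Hlip : forall u v, u <= v ->
    Rabs (log_slope t (Rmax 1 v) - log_slope t (Rmax 1 u)) <= v - u).
  { intros u v Huv.
    eapply Rle_trans; [apply log_slope_lipschitz; trivial; [apply Rmax_l|]|].
    - apply Rle_max_compat_l, Huv.
    - unfold Rmax; destruct (Rle_dec 1 v), (Rle_dec 1 u); lra. }
  destruct (Rle_dec x y) as [Hxy|Hxy].
  - rewrite Rabs_pos_eq in Hy by lra; specialize (Hlip x y Hxy); lra.
  - specialize (Hlip y x ltac:(lra)); rewrite Rabs_minus_sym.
    rewrite Rabs_left in Hy by lra; lra.
Qed.

Lemma log_slope_surjective (t y : R) : 0 < t -> log_slope t 1 < y ->
  exists k, 1 < k /\ log_slope t k = y.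
Proof.
  intros Ht Hy.
  (* Chosen so that the lower bound K - t of [log_slope t K] is at least [y]. *)
  set (K := Rmax 1 (y + t)).
  assert (HK : 1 <= K) by apply Rmax_l.
  assert (HyK : y <= log_slope t K).
  { eapply Rle_trans; [|apply log_slope_lower; lra].
    pose proof (Rmax_r 1 (y + t)); fold K in H; lra. }
  destruct (IVT_gen (fun k => log_slope t (Rmax 1 k)) 1 K y) as [k [Hk Heq]].
  - apply continuity_log_slope, Ht.
  - rewrite (Rmax_left 1 1), (Rmax_right 1 K) by lra.
    split; [eapply Rle_trans; [apply Rmin_l|lra]
           | eapply Rle_trans; [exact HyK|apply Rmax_r]].
  - rewrite Rmin_left, Rmax_right in Hk by lra.
    rewrite Rmax_right in Heq by lra.
    exists k; split; [|exact Heq].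
    destruct (Rle_lt_or_eq_dec 1 k (proj1 Hk)) as [|<-]; [assumption|lra].
Qed.

(** Minus the logarithmic derivative of erfc(eta/2) at eta = alpha. *)
Definition tail_slope (alpha : R) : R :=
  exp (- (alpha ^ 2 / 4)) / (sqrt PI * erfc (alpha / 2)).

Lemma tail_slope_pos (alpha : R) : 0 < tail_slope alpha.
Proof.
  pose proof sqrt_PI_pos; pose proof (erfc_pos (alpha / 2)).
  apply Rdiv_lt_0_compat; [apply exp_pos|nra].
Qed.

(** Logarithmic derivative at alpha of the inner solution minus that of the outer one: a continuous
    gluing with value u at alpha has derivative jump - u [jump_ratio]. *)
Definition jump_ratio (alpha k : R) : R :=
  log_slope (alpha ^ 2 / 4) k / alpha + tail_slope alpha.

Section Matching.

Variables alpha beta : R.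
Hypothesis Halpha : 0 < alpha.
Hypothesis Hbeta : 0 < beta.

Let t_pos : 0 < alpha ^ 2 / 4.
Proof. pose proof (pow_lt alpha 2 Halpha); lra. Qed.

Lemma jump_ratio_pos (k : R) : 1 <= k -> 0 < jump_ratio alpha k.
Proof.
  intros Hk; unfold jump_ratio.
  pose proof (log_slope_nonneg (alpha ^ 2 / 4) k ltac:(lra) Hk).
  pose proof (tail_slope_pos alpha).
  assert (0 <= log_slope (alpha ^ 2 / 4) k / alpha); [|lra].
  apply Rle_div_r; lra.
Qed.

Lemma jump_ratio_increasing (k1 k2 : R) : 1 <= k1 -> k1 < k2 ->
  jump_ratio alpha k1 < jump_ratio alpha k2.
Proof.
  intros Hk1 Hlt; unfold jump_ratio.
  apply Rplus_lt_compat_r, Rmult_lt_compat_r; [apply Rinv_0_lt_compat, Halpha|].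
  apply log_slope_increasing; assumption.
Qed.

Lemma jump_ratio_surjective (y : R) : jump_ratio alpha 1 < y ->
  exists k, 1 < k /\ jump_ratio alpha k = y.
Proof.
  unfold jump_ratio; intros Hy.
  destruct (log_slope_surjective (alpha ^ 2 / 4) ((y - tail_slope alpha) * alpha))
    as [k [Hk Heq]]; trivial.
  - apply -> Rlt_div_l; lra.
  - exists k; split; [exact Hk|]; rewrite Heq; field; lra.
Qed.

Lemma ustar_of_jump_ratio (gamma : R) : 0 <= gamma ->
  ustar_of alpha beta gamma = alpha * beta / 2 / jump_ratio alpha (kappa gamma).
Proof.
  intros Hg.
  pose proof (kappa_ge_1 gamma Hg) as Hk.
  pose proof (jump_ratio_pos _ Hk) as Hq.
  pose proof (KA_pos _ Hk _ (Rlt_le _ _ t_pos)) as HA.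
  assert (Heq : ustar_of alpha beta gamma
                = / jump_ratio alpha (kappa gamma) * (alpha * beta / 2));
    [|rewrite Heq; field; lra].
  unfold ustar_of; cbv zeta; f_equal; f_equal.
  fold (KA (kappa gamma) (alpha ^ 2 / 4)) (KB (kappa gamma) (alpha ^ 2 / 4)).
  unfold jump_ratio, log_slope, tail_slope; f_equal; field; lra.
Qed.

Lemma ustar_of_decreasing (g1 g2 : R) : 0 <= g1 -> g1 < g2 ->
  ustar_of alpha beta g2 < ustar_of alpha beta g1.
Proof.
  intros H1 Hlt; rewrite !ustar_of_jump_ratio by lra.
  pose proof (jump_ratio_pos _ (kappa_ge_1 g1 H1)).
  pose proof (jump_ratio_increasing _ _ (kappa_ge_1 g1 H1)
                (kappa_increasing g1 g2 H1 Hlt)).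
  apply Rmult_lt_compat_l; [nra|]; apply Rinv_lt_contravar; nra.
Qed.

Lemma ustar_of_injective (g1 g2 : R) : 0 <= g1 -> 0 <= g2 ->
  ustar_of alpha beta g1 = ustar_of alpha beta g2 -> g1 = g2.
Proof.
  intros H1 H2 Heq; destruct (Rtotal_order g1 g2) as [Hlt|[|Hlt]]; trivial.
  - pose proof (ustar_of_decreasing g1 g2 H1 Hlt); lra.
  - pose proof (ustar_of_decreasing g2 g1 H2 Hlt); lra.
Qed.

Lemma matching_condition (ustar : R) : 0 < ustar ->
  (exists! gamma : R, 0 < gamma /\ ustar_of alpha beta gamma = ustar) <->
  ustar < ustar_of alpha beta 0.
Proof.
  intros Hu; split.
  - intros [gamma [[Hg <-] _]]; apply ustar_of_decreasing; lra.
  - intros Hlt.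
    assert (Hab : 0 < alpha * beta / 2) by nra.
    (* The matching condition is solved for k first; gamma = k (k - 1) then has [kappa] equal to
       k. *)
    destruct (jump_ratio_surjective (alpha * beta / 2 / ustar)) as [k [Hk Heq]].
    + rewrite ustar_of_jump_ratio, kappa_0 in Hlt by lra.
      pose proof (jump_ratio_pos 1 ltac:(lra)).
      apply Rlt_div_r; [exact Hu|].
      apply (Rlt_div_r ustar) in Hlt; lra.
    + assert (Hg : 0 < k * (k - 1)) by nra.
      assert (Hm : ustar_of alpha beta (k * (k - 1)) = ustar).
      { rewrite ustar_of_jump_ratio, kappa_of_product, Heq by lra; field; lra. }
      exists (k * (k - 1)); split; [split; assumption|].
      intros g [Hg' Hm']; apply ustar_of_injective; lra.
Qed.

End Matching.

(** * Existence and uniqueness *)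

(** Two solutions of f'' = c f - x/2 f' have a Wronskian W with W' = - x/2 W, so exp(x^2/4) is an
    integrating factor. The number [c] is the value at [x] of a coefficient that may vary. *)
Lemma is_derive_wronskian (c : R) (f f' g g' : R -> R) (x : R) :
  is_derive f x (f' x) -> is_derive g x (g' x) ->
  is_derive f' x (c * f x - x / 2 * f' x) ->
  is_derive g' x (c * g x - x / 2 * g' x) ->
  is_derive (fun y => exp (y ^ 2 / 4) * (f' y * g y - f y * g' y)) x 0.
Proof.
  intros Hf Hg Hf' Hg'; auto_derive.
  - repeat split; eexists; eassumption.
  - change (Derive (fun y => f y) x) with (Derive f x).
    change (Derive (fun y => g y) x) with (Derive g x).
    change (Derive (fun y => f' y) x) with (Derive f' x).
    change (Derive (fun y => g' y) x) with (Derive g' x).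
    rewrite (is_derive_unique _ _ _ Hf), (is_derive_unique _ _ _ Hg),
      (is_derive_unique _ _ _ Hf'), (is_derive_unique _ _ _ Hg'); field.
Qed.

(** The order-convex predicate [P] serves both for the interval (0, alpha) and for the half-line
    (alpha, oo). *)
Lemma constant_of_derive_0 (f : R -> R) (P : R -> Prop) :
  (forall x y z, P x -> P y -> x <= z <= y -> P z) ->
  (forall x, P x -> is_derive f x 0) ->
  forall x y, P x -> P y -> f x = f y.
Proof.
  intros Hconv Hd.
  assert (H : forall x y, P x -> P y -> x < y -> f x = f y).
  { intros x y Hx Hy Hxy; apply (eq_is_derive f x y); trivial.
    intros t Ht; apply Hd, (Hconv x y); assumption. }
  intros x y Hx Hy; destruct (Rtotal_order x y) as [Hlt|[->|Hlt]].
  - apply H; assumption.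
  - reflexivity.
  - symmetry; apply H; assumption.
Qed.

Lemma at_right_0_abs_lt (f : R -> R) (eps : R) : 0 < eps ->
  filterlim f (at_right 0) (locally 0) ->
  exists d, 0 < d /\ forall x, 0 < x < d -> Rabs (f x) < eps.
Proof.
  intros He Hf.
  destruct (Hf _ (locally_ball 0 (mkposreal eps He))) as [d Hd].
  exists d; split; [apply cond_pos|]; intros x Hx.
  specialize (Hd x); rewrite <- (Rminus_0_r (f x)); apply Hd; [|lra].
  change (Rabs (x - 0) < d); rewrite Rabs_pos_eq; lra.
Qed.

(* Only the difference quotient of [Psi] at 0 is controlled; the mean value
   theorem on [h / 2, h] gives arbitrarily small points where [Derive Psi] is
   small, which is enough because the weighted Wronskian with [profile k] is
   constant. *)
Lemma wronskian_vanishes (alpha k : R) (Psi : R -> R) : 0 < alpha -> 1 < k ->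
  (forall x, 0 < x < alpha -> is_derive Psi x (Derive Psi x)) ->
  (forall x, 0 < x < alpha -> is_derive (Derive Psi) x
     (k * (k - 1) / x ^ 2 * Psi x - x / 2 * Derive Psi x)) ->
  filterlim (fun h => (Psi h - Psi 0) / h) (at_right 0) (locally 0) ->
  forall x, 0 < x < alpha ->
    Derive Psi x * profile k x - Psi x * slope k x = 0.
Proof.
  intros Ha Hk Hd Hdd Hq.
  set (W := fun y => exp (y ^ 2 / 4)
                     * (Derive Psi y * profile k y - Psi y * slope k y)).
  assert (HW : forall x y, 0 < x < alpha -> 0 < y < alpha -> W x = W y).
  { apply (constant_of_derive_0 W (fun x => 0 < x < alpha));
      [intros; lra|].
    intros x Hx; apply (is_derive_wronskian (k * (k - 1) / x ^ 2)).
    - apply Hd, Hx.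
    - apply is_derive_profile; lra.
    - apply Hdd, Hx.
    - apply is_derive_slope; lra. }
  (* The 4 collects 3 eps from the bound on [Derive Psi] and 1 from the bound |Psi(0)| + 1 on
     [Psi]. *)
  set (K := exp (alpha ^ 2 / 4) * (4 + Rabs (Psi 0))).
  assert (HK : 0 < K).
  { unfold K; pose proof (exp_pos (alpha ^ 2 / 4)).
    pose proof (Rabs_pos (Psi 0)); nra. }
  assert (Hsmall : forall eps, 0 < eps < 1 ->
            forall x, 0 < x < alpha -> Rabs (W x) <= K * eps).
  { intros eps Heps x Hx.
    destruct (at_right_0_abs_lt _ eps (proj1 Heps) Hq) as [d1 [Hd1 H1]].
    destruct (at_right_0_abs_lt _ eps (proj1 Heps)
                (filterlim_profile_0 k Hk)) as [d2 [Hd2 H2]].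
    destruct (at_right_0_abs_lt _ eps (proj1 Heps)
                (filterlim_slope_0 k Hk)) as [d3 [Hd3 H3]].
    set (h := Rmin (Rmin d1 d2) (Rmin d3 (Rmin alpha 1)) / 2).
    assert (Hh : 0 < h /\ h < d1 /\ h < d2 /\ h < d3 /\ h < alpha /\ h < 1).
    { assert (0 < 2 * h) by
        (unfold h; replace (2 * (_ / 2)) with
           (Rmin (Rmin d1 d2) (Rmin d3 (Rmin alpha 1))) by field;
         repeat apply Rmin_pos; lra).
      pose proof (Rmin_l (Rmin d1 d2) (Rmin d3 (Rmin alpha 1))).
      pose proof (Rmin_r (Rmin d1 d2) (Rmin d3 (Rmin alpha 1))).
      pose proof (Rmin_l d1 d2); pose proof (Rmin_r d1 d2).
      pose proof (Rmin_l d3 (Rmin alpha 1)); pose proof (Rmin_r d3 (Rmin alpha 1)).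
      pose proof (Rmin_l alpha 1); pose proof (Rmin_r alpha 1).
      unfold h in *; lra. }
    destruct (MVT_gen Psi (h / 2) h (Derive Psi)) as [xi [Hxi Heq]];
      rewrite Rmin_left, Rmax_right in * by lra.
    { intros y Hy; apply Hd; lra. }
    { intros y Hy; apply continuity_pt_filterlim, (ex_derive_continuous Psi).
      eexists; apply Hd; lra. }
    assert (Hquot : forall y, 0 < y -> y < d1 ->
              - (eps * y) <= Psi y - Psi 0 <= eps * y).
    { intros y Hy Hyd; pose proof (Rabs_def2 _ _ (H1 y ltac:(lra))) as Hb.
      assert (Hy' : Psi y - Psi 0 = (Psi y - Psi 0) / y * y) by (field; lra).
      rewrite Hy'; nra. }
    pose proof (Hquot h ltac:(lra) ltac:(lra)) as Qh.
    pose proof (Hquot (h / 2) ltac:(lra) ltac:(lra)) as Qh2.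
    pose proof (Hquot xi ltac:(lra) ltac:(lra)) as Qx.
    (* Psi(h) and Psi(h/2) differ by at most eps (h + h/2), and dividing by the length h/2 gives 3
       eps. *)
    assert (HD : Rabs (Derive Psi xi) <= 3 * eps).
    { apply Rabs_le; replace (Derive Psi xi)
        with ((Psi h - Psi (h / 2)) / (h / 2)) by (rewrite Heq; field; lra).
      split; [apply Rle_div_r | apply Rle_div_l]; nra. }
    assert (HP : Rabs (Psi xi) <= Rabs (Psi 0) + 1).
    { replace (Psi xi) with (Psi 0 + (Psi xi - Psi 0)) by ring.
      eapply Rle_trans; [apply Rabs_triang|]; apply Rplus_le_compat_l.
      apply Rabs_le; nra. }
    rewrite (HW x xi Hx ltac:(lra)); unfold W, K.
    rewrite Rabs_mult, Rabs_pos_eq, Rmult_assoc by (left; apply exp_pos).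
    apply Rmult_le_compat; [left; apply exp_pos|apply Rabs_pos| |].
    - assert (xi ^ 2 <= alpha ^ 2) by nra.
      destruct (Req_dec (xi ^ 2) (alpha ^ 2)) as [->|]; [right; reflexivity|].
      left; apply exp_increasing; lra.
    - unfold Rminus; eapply Rle_trans; [apply Rabs_triang|].
      rewrite Rabs_Ropp, !Rabs_mult.
      specialize (H2 xi ltac:(lra)); specialize (H3 xi ltac:(lra)).
      assert (Rabs (Derive Psi xi) * Rabs (profile k xi) <= 3 * eps * 1)
        by (apply Rmult_le_compat; try apply Rabs_pos; lra).
      assert (Rabs (Psi xi) * Rabs (slope k xi) <= (Rabs (Psi 0) + 1) * eps)
        by (apply Rmult_le_compat; try apply Rabs_pos; lra).
      lra. }
  intros x Hx.
  assert (HW0 : W x = 0).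
  { destruct (Req_dec (W x) 0) as [|Hne]; [assumption|exfalso].
    pose proof (Rabs_pos_lt _ Hne) as Hpos.
    assert (Hlt : 0 < Rabs (W x) / (2 * K)) by (apply Rdiv_lt_0_compat; lra).
    (* With this minimum as eps, the bound K eps gives |W x| <= |W x| / 2, a contradiction. *)
    pose proof (Rmin_l (1 / 2) (Rabs (W x) / (2 * K))).
    pose proof (Rmin_r (1 / 2) (Rabs (W x) / (2 * K))) as Hr.
    pose proof (Rmin_pos (1 / 2) _ ltac:(lra) Hlt).
    pose proof (Hsmall (Rmin (1 / 2) (Rabs (W x) / (2 * K))) ltac:(lra) x Hx).
    apply (Rmult_le_compat_l K) in Hr; [|lra].
    replace (K * (Rabs (W x) / (2 * K))) with (Rabs (W x) / 2) in Hr
      by (field; lra).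
    lra. }
  unfold W in HW0; apply Rmult_integral in HW0 as [He|]; trivial.
  pose proof (exp_pos (x ^ 2 / 4)); lra.
Qed.

(** The derivative of [Psi] / [profile k] is the Wronskian over the square of [profile k], hence
    zero. *)
Lemma inner_solution_unique (alpha k : R) (Psi : R -> R) : 0 < alpha -> 1 < k ->
  (forall x, 0 < x < alpha -> is_derive Psi x (Derive Psi x)) ->
  (forall x, 0 < x < alpha -> is_derive (Derive Psi) x
     (k * (k - 1) / x ^ 2 * Psi x - x / 2 * Derive Psi x)) ->
  filterlim (fun h => (Psi h - Psi 0) / h) (at_right 0) (locally 0) ->
  exists c, forall x, 0 < x < alpha -> Psi x = c * profile k x.
Proof.
  intros Ha Hk Hd Hdd Hq.
  assert (Hcst : forall x y, 0 < x < alpha -> 0 < y < alpha ->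
            Psi x / profile k x = Psi y / profile k y).
  { apply (constant_of_derive_0 (fun x => Psi x / profile k x));
      [intros; lra|].
    intros x Hx.
    pose proof (profile_pos k ltac:(lra) x ltac:(lra)).
    pose proof (is_derive_profile k ltac:(lra) x ltac:(lra)) as Hp.
    replace 0 with ((Derive Psi x * profile k x - Psi x * slope k x)
                    / profile k x ^ 2).
    - apply is_derive_div; [apply Hd, Hx|exact Hp|lra].
    - rewrite (wronskian_vanishes alpha k Psi Ha Hk Hd Hdd Hq x Hx); field; lra. }
  exists (Psi (alpha / 2) / profile k (alpha / 2)); intros x Hx.
  rewrite (Hcst (alpha / 2) x) by lra.
  pose proof (profile_pos k ltac:(lra) x ltac:(lra)); field; lra.
Qed.

(** Here exp(x^2/4) Psi' is a constant K, so Psi + K sqrt(PI) erfc(x/2) is constant as well, and the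
    decay at infinity makes that constant 0. *)
Lemma outer_solution_unique (alpha : R) (Psi : R -> R) :
  (forall x, alpha < x -> is_derive Psi x (Derive Psi x)) ->
  (forall x, alpha < x -> is_derive (Derive Psi) x (- (x / 2 * Derive Psi x))) ->
  is_lim Psi p_infty 0 ->
  exists d, forall x, alpha < x -> Psi x = d * erfc (x / 2).
Proof.
  intros Hd Hdd Hlim.
  set (K := exp ((alpha + 1) ^ 2 / 4) * Derive Psi (alpha + 1)).
  assert (HK : forall x, alpha < x -> Derive Psi x = K * exp (- (x ^ 2 / 4))).
  { intros x Hx.
    assert (Heq : exp (x ^ 2 / 4) * Derive Psi x = K).
    { apply (constant_of_derive_0 (fun x => exp (x ^ 2 / 4) * Derive Psi x)
               (fun x => alpha < x)); try lra; [intros; lra|].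
      intros y Hy; auto_derive; [eexists; apply Hdd, Hy|].
      change (Derive (fun x => Derive Psi x) y)
        with (Derive (Derive Psi) y).
      rewrite (is_derive_unique _ _ _ (Hdd y Hy)); field. }
    rewrite <- Heq, exp_Ropp; pose proof (exp_pos (x ^ 2 / 4)); field; lra. }
  set (F := fun x => Psi x + K * sqrt PI * erfc (x / 2)).
  assert (HF : forall x y, alpha < x -> alpha < y -> F x = F y).
  { apply (constant_of_derive_0 F); [intros; lra|].
    intros x Hx; pose proof sqrt_PI_pos.
    replace 0 with (Derive Psi x
                    + K * sqrt PI * (- (/ sqrt PI * exp (- (x ^ 2 / 4)))))
      by (rewrite HK by exact Hx; field; lra).
    apply (is_derive_plus (V := R_NormedModule)); [apply Hd, Hx|].
    apply (is_derive_scal (fun x => erfc (x / 2))), is_derive_erfc_half. }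
  assert (HlimF : is_lim F p_infty 0).
  { replace (Finite 0) with (Finite (0 + K * sqrt PI * 0)) by (f_equal; ring).
    apply is_lim_plus'; [exact Hlim|].
    apply (is_lim_scal_l (fun x => erfc (x / 2)) (K * sqrt PI) p_infty 0).
    exact is_lim_erfc_half. }
  exists (- (K * sqrt PI)); intros x Hx.
  assert (HF0 : F x = 0).
  { assert (Hc : is_lim F p_infty (F x)).
    { apply is_lim_ext_loc with (fun _ => F x); [|apply is_lim_const].
      exists alpha; intros y Hy; apply HF; assumption. }
    apply is_lim_unique in Hc; apply is_lim_unique in HlimF.
    rewrite Hc in HlimF; injection HlimF; trivial. }
  unfold F in HF0; lra.
Qed.

(** Used to determine Psi(0), which the equation on the open half-line does not see. *)
Lemma filterlim_of_right_derivative (f : R -> R) (l : R) :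
  filterlim (fun h => (f h - f 0) / h) (at_right 0) (locally l) ->
  filterlim f (at_right 0) (locally (f 0)).
Proof.
  intros Hq.
  apply filterlim_ext_loc with (fun h => (f h - f 0) / h * h + f 0).
  { apply (filter_imp (fun y => 0 < y < 1)); [|apply at_right_between; lra].
    intros y Hy; field; lra. }
  assert (H : filterlim (fun h => (f h - f 0) / h * h + f 0) (at_right 0)
                (locally (l * 0 + f 0))).
  { eapply filterlim_comp_2;
      [|apply filterlim_const|apply (filterlim_plus (l * 0) (f 0))].
    apply filterlim_Rmult; [apply within_filter, locally_filter|exact Hq|].
    apply (filterlim_filter_le_1 (F := locally 0)); [apply filter_le_within|].
    apply filterlim_id. }
  rewrite Rmult_0_r, Rplus_0_l in H; exact H.
Qed.

(** * The function Phi_gamma as the solution for a given gamma *)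

Lemma Phi_of_left (alpha beta gamma eta : R) : eta < alpha ->
  Phi_of alpha beta gamma eta
  = ustar_of alpha beta gamma / profile (kappa gamma) alpha
    * profile (kappa gamma) eta.
Proof.
  intros Hlt; unfold Phi_of; cbv zeta.
  destruct (Rlt_dec eta alpha); [|lra].
  unfold profile, KA, Rdiv; ring.
Qed.

Lemma Phi_of_right (alpha beta gamma eta : R) : alpha <= eta ->
  Phi_of alpha beta gamma eta
  = ustar_of alpha beta gamma / erfc (alpha / 2) * erfc (eta / 2).
Proof.
  intros Hle; unfold Phi_of; cbv zeta.
  destruct (Rlt_dec eta alpha); [lra|reflexivity].
Qed.

Section Solution.

Variables alpha beta gamma : R.
Hypothesis Halpha : 0 < alpha.
Hypothesis Hgamma : 0 < gamma.

Let k := kappa gamma.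
Let u := ustar_of alpha beta gamma.
Let c := u / profile k alpha.
Let d := u / erfc (alpha / 2).

Let Hk : 1 < k.
Proof. apply kappa_gt_1, Hgamma. Qed.

Lemma slope_profile_alpha :
  slope k alpha / profile k alpha = log_slope (alpha ^ 2 / 4) k / alpha.
Proof.
  pose proof (KA_pos k ltac:(lra) (alpha ^ 2 / 4)
                ltac:(pose proof (pow2_ge_0 alpha); lra)).
  pose proof (exp_pos ((k - 1) * ln alpha)) as Hp.
  change (0 < Rpower alpha (k - 1)) in Hp.
  unfold slope, profile, log_slope.
  rewrite rpow_pos_arg, (Rpower_pred k) by exact Halpha; field; lra.
Qed.

Let is_derive_left (x : R) : 0 < x < alpha ->
  is_derive (Phi_of alpha beta gamma) x (c * slope k x).
Proof.
  intros Hx; apply is_derive_ext_loc with (fun y => c * profile k y).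
  - apply (filter_imp (fun y => 0 < y < alpha)); [|apply locally_between, Hx].
    intros y Hy; symmetry; apply Phi_of_left; lra.
  - apply (is_derive_scal (profile k)), is_derive_profile; lra.
Qed.

Let is_derive_right (x : R) : alpha < x ->
  is_derive (Phi_of alpha beta gamma) x
    (d * - (/ sqrt PI * exp (- (x ^ 2 / 4)))).
Proof.
  intros Hx; apply is_derive_ext_loc with (fun y => d * erfc (y / 2)).
  - apply (filter_imp (fun y => alpha < y)); [|apply open_gt, Hx].
    intros y Hy; symmetry; apply Phi_of_right; lra.
  - apply (is_derive_scal (fun y => erfc (y / 2))), is_derive_erfc_half.
Qed.

Let is_derive2_left (x : R) : 0 < x < alpha ->
  is_derive (Derive (Phi_of alpha beta gamma)) x
    (c * (k * (k - 1) / x ^ 2 * profile k x - x / 2 * slope k x)).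
Proof.
  intros Hx; apply is_derive_ext_loc with (fun y => c * slope k y).
  - apply (filter_imp (fun y => 0 < y < alpha)); [|apply locally_between, Hx].
    intros y Hy; symmetry; apply is_derive_unique, is_derive_left, Hy.
  - apply (is_derive_scal (slope k)), is_derive_slope; lra.
Qed.

Let is_derive2_right (x : R) : alpha < x ->
  is_derive (Derive (Phi_of alpha beta gamma)) x
    (d * (/ sqrt PI * exp (- (x ^ 2 / 4)) * (x / 2))).
Proof.
  intros Hx.
  apply is_derive_ext_loc
    with (fun y => d * - (/ sqrt PI * exp (- (y ^ 2 / 4)))).
  - apply (filter_imp (fun y => alpha < y)); [|apply open_gt, Hx].
    intros y Hy; symmetry; apply is_derive_unique, is_derive_right, Hy.
  - auto_derive; [trivial|].
    change (x * (x * 1) * / 4) with (x ^ 2 / 4); field.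
    pose proof sqrt_PI_pos; lra.
Qed.

Lemma continuous_Phi_of : continuous (Phi_of alpha beta gamma) alpha.
Proof.
  pose proof (profile_pos k ltac:(lra) alpha Halpha) as Hp.
  pose proof (erfc_pos (alpha / 2)) as He.
  assert (Hu : Phi_of alpha beta gamma alpha = u).
  { rewrite Phi_of_right by lra; fold u; field; lra. }
  assert (C1 : filterlim (fun y => c * profile k y) (locally alpha) (locally u)).
  { replace u with (c * profile k alpha) by (unfold c; field; lra).
    apply (ex_derive_continuous (fun y => c * profile k y)).
    eexists; apply (is_derive_scal (profile k)), is_derive_profile; lra. }
  assert (C2 : filterlim (fun y => d * erfc (y / 2)) (locally alpha) (locally u)).
  { replace u with (d * erfc (alpha / 2)) by (unfold d; field; lra).
    apply (ex_derive_continuous (fun y => d * erfc (y / 2))).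
    eexists; apply (is_derive_scal (fun y => erfc (y / 2))).
    apply is_derive_erfc_half. }
  (* Each value of [Phi_of] comes from one of two branches, both continuous at alpha with value [u];
     near alpha both land in [P]. *)
  intros P HP; rewrite Hu in HP; unfold filtermap.
  apply (filter_imp (fun y => P (c * profile k y) /\ P (d * erfc (y / 2))));
    [|apply filter_and; [exact (C1 P HP)|exact (C2 P HP)]].
  intros y [H1 H2]; destruct (Rlt_dec y alpha).
  - rewrite Phi_of_left by assumption; exact H1.
  - rewrite Phi_of_right by lra; exact H2.
Qed.

Lemma Phi_of_satisfies_equation :
  satisfies_equation alpha beta gamma (Phi_of alpha beta gamma).
Proof.
  split; [exact continuous_Phi_of|split].
  - intros x Hx Hxa; destruct (Rlt_dec x alpha) as [Hlt|Hge].
    + split; [eexists; apply is_derive_left; lra|].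
      split; [eexists; apply is_derive2_left; lra|].
      rewrite (is_derive_unique _ _ _ (is_derive2_left x ltac:(lra))).
      rewrite (is_derive_unique _ _ _ (is_derive_left x ltac:(lra))).
      rewrite Phi_of_left by assumption; fold k u c.
      unfold heaviside; destruct (Rlt_dec 0 (alpha - x)); [|lra].
      unfold k; rewrite kappa_spec by lra; field; lra.
    + split; [eexists; apply is_derive_right; lra|].
      split; [eexists; apply is_derive2_right; lra|].
      rewrite (is_derive_unique _ _ _ (is_derive2_right x ltac:(lra))).
      rewrite (is_derive_unique _ _ _ (is_derive_right x ltac:(lra))).
      unfold heaviside; destruct (Rlt_dec 0 (alpha - x)); [lra|].
      pose proof sqrt_PI_pos; field; lra.
  - exists (c * slope k alpha),
      (d * - (/ sqrt PI * exp (- (alpha ^ 2 / 4)))).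
    split; [|split].
    + apply filterlim_ext_loc with (fun y => c * slope k y).
      { apply (filter_imp (fun y => 0 < y < alpha));
          [|apply at_left_between, Halpha].
        intros y Hy; symmetry; apply is_derive_unique, is_derive_left, Hy. }
      apply (filterlim_filter_le_1 (F := locally alpha));
        [apply filter_le_within|].
      apply (ex_derive_continuous (fun y => c * slope k y)).
      eexists; apply (is_derive_scal (slope k)), is_derive_slope; lra.
    + apply filterlim_ext_loc
        with (fun y => d * - (/ sqrt PI * exp (- (y ^ 2 / 4)))).
      { apply (filter_imp (fun y => alpha < y < alpha + 1));
          [|apply at_right_between; lra].
        intros y Hy; symmetry; apply is_derive_unique, is_derive_right, Hy. }
      apply (filterlim_filter_le_1 (F := locally alpha));
        [apply filter_le_within|].
      apply (ex_derive_continuous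
               (fun y => d * - (/ sqrt PI * exp (- (y ^ 2 / 4))))).
      auto_derive; trivial.
    + pose proof (jump_ratio_pos alpha Halpha k ltac:(lra)) as Hq.
      pose proof (profile_pos k ltac:(lra) alpha Halpha).
      pose proof (erfc_pos (alpha / 2)); pose proof sqrt_PI_pos.
      (* [c] and [d] normalize both branches to the value [u] at alpha, and [u] is alpha beta / 2
         divided by [jump_ratio]. *)
      transitivity (- (u * jump_ratio alpha k)).
      * unfold jump_ratio; rewrite <- slope_profile_alpha.
        unfold tail_slope, c, d; field; lra.
      * unfold u; rewrite ustar_of_jump_ratio by lra; fold k; field; lra.
Qed.

Lemma Phi_of_is_solution :
  is_solution alpha beta (ustar_of alpha beta gamma) (Phi_of alpha beta gamma)
    gamma.
Proof.
  split; [exact Hgamma|split; [exact Phi_of_satisfies_equation|split; [|split]]].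
  - apply is_lim_ext_loc with (fun y => d * erfc (y / 2)).
    { exists alpha; intros y Hy; symmetry; apply Phi_of_right; lra. }
    replace (Finite 0) with (Rbar_mult d 0) by (simpl; f_equal; ring).
    apply is_lim_scal_l, is_lim_erfc_half.
  - rewrite Phi_of_right by lra; pose proof (erfc_pos (alpha / 2)); field; lra.
  - apply filterlim_ext_loc with (fun y => c * (profile k y / y)).
    { apply (filter_imp (fun y => 0 < y < alpha));
        [|apply at_right_between, Halpha].
      intros y Hy; rewrite !Phi_of_left by lra; fold k u c.
      rewrite (profile_nonpos_arg k 0) by lra; field; lra. }
    replace 0 with (c * 0) at 2 by ring.
    apply filterlim_Rmult; [apply within_filter, locally_filter| |].
    + apply filterlim_const.
    + apply filterlim_profile_div_0, Hk.
Qed.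

(** The matching condition is a conclusion here: Psi is c' [profile k] inside and d' erfc(eta/2)
    outside, continuity at alpha fixes c' and d' in terms of [ustar], and the jump condition then
    forces [ustar] to be u*_gamma. *)
Lemma solution_unique (ustar : R) (Psi : R -> R) :
  is_solution alpha beta ustar Psi gamma ->
  ustar_of alpha beta gamma = ustar /\
  forall eta, 0 <= eta -> Psi eta = Phi_of alpha beta gamma eta.
Proof.
  intros [_ [[Hcont [Heqn [dl [dr [Hl [Hr Hjump]]]]]] [Hlim [Hval Hq]]]].
  pose proof (profile_pos k ltac:(lra) alpha Halpha) as Hp.
  pose proof (erfc_pos (alpha / 2)) as He; pose proof sqrt_PI_pos as Hpi.
  pose proof (jump_ratio_pos alpha Halpha k ltac:(lra)) as Hjr.
  assert (Hd1 : forall x, 0 < x -> x <> alpha -> is_derive Psi x (Derive Psi x)).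
  { intros x Hx Hxa; apply Derive_correct, (Heqn x Hx Hxa). }
  assert (Hd2 : forall x, 0 < x -> x <> alpha ->
            is_derive (Derive Psi) x (Derive (Derive Psi) x)).
  { intros x Hx Hxa; apply Derive_correct, (Heqn x Hx Hxa). }
  destruct (inner_solution_unique alpha k Psi) as [c' Hc']; trivial.
  { intros x Hx; apply Hd1; lra. }
  { intros x Hx.
    replace (_ - _) with (Derive (Derive Psi) x); [apply Hd2; lra|].
    destruct (Heqn x ltac:(lra) ltac:(lra)) as [_ [_ E]].
    unfold heaviside in E; destruct (Rlt_dec 0 (alpha - x)); [|lra].
    unfold k; rewrite kappa_spec by lra; lra. }
  destruct (outer_solution_unique alpha Psi) as [d' Hd']; trivial.
  { intros x Hx; apply Hd1; lra. }
  { intros x Hx.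
    replace (- _) with (Derive (Derive Psi) x); [apply Hd2; lra|].
    destruct (Heqn x ltac:(lra) ltac:(lra)) as [_ [_ E]].
    unfold heaviside in E; destruct (Rlt_dec 0 (alpha - x)); lra. }
  assert (Hc : c' * profile k alpha = ustar).
  { apply (filterlim_locally_unique (F := at_left alpha) Psi).
    - apply filterlim_ext_loc with (fun x => c' * profile k x).
      + apply (filter_imp (fun y => 0 < y < alpha));
          [|apply at_left_between, Halpha].
        intros y Hy; symmetry; apply Hc', Hy.
      + apply (filterlim_filter_le_1 (F := locally alpha));
          [apply filter_le_within|].
        apply (ex_derive_continuous (fun y => c' * profile k y)).
        eexists; apply (is_derive_scal (profile k)), is_derive_profile; lra.
    - rewrite <- Hval.
      apply (filterlim_filter_le_1 (F := locally alpha));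
        [apply filter_le_within|exact Hcont]. }
  assert (Hd : d' * erfc (alpha / 2) = ustar).
  { apply (filterlim_locally_unique (F := at_right alpha) Psi).
    - apply filterlim_ext_loc with (fun x => d' * erfc (x / 2)).
      + apply (filter_imp (fun y => alpha < y < alpha + 1));
          [|apply at_right_between; lra].
        intros y Hy; symmetry; apply Hd'; lra.
      + apply (filterlim_filter_le_1 (F := locally alpha));
          [apply filter_le_within|].
        apply (ex_derive_continuous (fun y => d' * erfc (y / 2))).
        eexists; apply (is_derive_scal (fun y => erfc (y / 2))).
        apply is_derive_erfc_half.
    - rewrite <- Hval.
      apply (filterlim_filter_le_1 (F := locally alpha));
        [apply filter_le_within|exact Hcont]. }
  assert (Hdl : dl = c' * slope k alpha).
  { apply (filterlim_locally_unique (F := at_left alpha) (Derive Psi));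
      [exact Hl|].
    apply filterlim_ext_loc with (fun x => c' * slope k x).
    - apply (filter_imp (fun y => 0 < y < alpha));
        [|apply at_left_between, Halpha].
      intros y Hy; symmetry; apply is_derive_unique.
      apply is_derive_ext_loc with (fun x => c' * profile k x).
      + apply (filter_imp (fun y => 0 < y < alpha)); [|apply locally_between, Hy].
        intros z Hz; symmetry; apply Hc', Hz.
      + apply (is_derive_scal (profile k)), is_derive_profile; lra.
    - apply (filterlim_filter_le_1 (F := locally alpha));
        [apply filter_le_within|].
      apply (ex_derive_continuous (fun y => c' * slope k y)).
      eexists; apply (is_derive_scal (slope k)), is_derive_slope; lra. }
  assert (Hdr : dr = d' * - (/ sqrt PI * exp (- (alpha ^ 2 / 4)))).
  { apply (filterlim_locally_unique (F := at_right alpha) (Derive Psi));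
      [exact Hr|].
    apply filterlim_ext_loc
      with (fun y => d' * - (/ sqrt PI * exp (- (y ^ 2 / 4)))).
    - apply (filter_imp (fun y => alpha < y < alpha + 1));
        [|apply at_right_between; lra].
      intros y Hy; symmetry; apply is_derive_unique.
      apply is_derive_ext_loc with (fun x => d' * erfc (x / 2)).
      + apply (filter_imp (fun y => alpha < y)); [|apply open_gt, Hy].
        intros z Hz; symmetry; apply Hd', Hz.
      + apply (is_derive_scal (fun y => erfc (y / 2))), is_derive_erfc_half.
    - apply (filterlim_filter_le_1 (F := locally alpha));
        [apply filter_le_within|].
      apply (ex_derive_continuous
               (fun y => d' * - (/ sqrt PI * exp (- (y ^ 2 / 4))))).
      auto_derive; trivial. }
  assert (Hc'' : c' = ustar / profile k alpha) by (rewrite <- Hc; field; lra).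
  assert (Hd'' : d' = ustar / erfc (alpha / 2)) by (rewrite <- Hd; field; lra).
  assert (Hmatch : ustar_of alpha beta gamma = ustar).
  { rewrite ustar_of_jump_ratio by lra; fold k.
    (* The prescribed jump, with both one-sided derivatives expressed through [ustar]. *)
    assert (E : ustar * jump_ratio alpha k = alpha * beta / 2).
    { transitivity (- (dr - dl)); [|lra].
      rewrite Hdl, Hdr, Hc'', Hd''.
      unfold jump_ratio; rewrite <- slope_profile_alpha.
      unfold tail_slope; field; lra. }
    rewrite <- E; field; lra. }
  split; [exact Hmatch|].
  intros eta [Hpos|<-].
  - destruct (Rtotal_order eta alpha) as [Hlt|[->|Hgt]].
    + rewrite Phi_of_left, Hc', Hmatch, Hc'' by lra; reflexivity.
    + rewrite Phi_of_right, Hmatch, Hval by lra; field; lra.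
    + rewrite Phi_of_right, Hd', Hmatch, Hd'' by lra; reflexivity.
  - rewrite Phi_of_left, (profile_nonpos_arg _ 0), Rmult_0_r by lra.
    (* Psi(0) is the right limit of Psi, and c' [profile k] tends to 0 there. *)
    apply (filterlim_locally_unique (F := at_right 0) Psi).
    + apply (filterlim_of_right_derivative Psi 0), Hq.
    + apply filterlim_ext_loc with (fun x => c' * profile k x).
      { apply (filter_imp (fun y => 0 < y < alpha));
          [|apply at_right_between, Halpha].
        intros y Hy; symmetry; apply Hc', Hy. }
      replace 0 with (c' * 0) at 2 by ring.
      apply filterlim_Rmult; [apply within_filter, locally_filter| |].
      * apply filterlim_const.
      * apply filterlim_profile_0, Hk.
Qed.

End Solution.

Theorem theorem7 (alpha beta ustar : R)
    (Halpha : 0 < alpha) (Hbeta : 0 < beta) (Hustar : 0 < ustar) :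
  ((exists! gamma : R, 0 < gamma /\ ustar_of alpha beta gamma = ustar) <->
     ustar < ustar_of alpha beta 0) /\
  (ustar < ustar_of alpha beta 0 ->
   forall gamma : R, 0 < gamma -> ustar_of alpha beta gamma = ustar ->
     is_solution alpha beta ustar (Phi_of alpha beta gamma) gamma /\
     (forall (Psi : R -> R) (gamma' : R),
        is_solution alpha beta ustar Psi gamma' ->
        gamma' = gamma /\
        (forall eta : R, 0 <= eta -> Psi eta = Phi_of alpha beta gamma eta))).
Proof.
  split; [apply matching_condition; assumption|].
  intros _ gamma Hg Hm; split.
  - rewrite <- Hm; apply Phi_of_is_solution; assumption.
  - intros Psi gamma' Hsol.
    pose proof (proj1 Hsol) as Hg'.
    destruct (solution_unique alpha beta gamma' Halpha Hg' ustar Psi Hsol)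
      as [Hm' HPsi].
    (* Both parameters satisfy the matching condition for the same [ustar], and u*_gamma is strictly
       decreasing in gamma. *)
    assert (gamma' = gamma) as ->
      by (apply (ustar_of_injective alpha beta); lra).
    split; trivial.
Qed.
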